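(* For every $\rho>0$, every $\delta\in(0,1)$, every $\Delta_0\in\mathbb{N}$, every number of iterations $I\in\mathbb{N}$, $I\ge1$, and every ratio $r>0$, the DP-SIPS mechanism with these parameters satisfies $\delta$-approximate $\rho$-zCDP, where neighboring datasets are those differing by the addition or removal of one user's list.
   Context: Let $\mathcal{U}$ be a (possibly infinite) universe of items. A dataset is a finite sequence $x=(W_1,\dots,W_N)$ of user lists $W_i\in\mathcal{U}^*$. Datasets $x,x'$ are neighbors if one is obtained from the other by adding one user list. Let $\Phi$ be the standard normal CDF and $[\Delta_0]=\{1,\dots,\Delta_0\}$. The Weighted Gaussian mechanism $\mathrm{WG}_{\rho,\delta,\Delta_0}(x)$: (1) For each user $i$, remove duplicates from $W_i$, and let $\overline W_i$ be a uniformly random subset of at most $\Delta_0$ of its distinct items (all of them if at most $\Delta_0$). (2) Set $H[u]=\sum_{i:\,u\in\overline W_i}1/\sqrt{|\overline W_i|}$ for $u\in\bigcup_i\overline W_i$. (3) Set $\sigma=1/\sqrt{2\rho}$ and $T=\max_{k\in[\Delta_0]}\{1/\sqrt{k}+\sigma\Phi^{-1}((1-\delta)^{1/k})\}$. (4) For each $u$ in the support of $H$ independently draw $Z_u\sim\mathcal{N}(0,1/(2\rho))$; output $\{u:H[u]+Z_u\ge T\}$. DP-SIPS with parameters $(\rho,\delta,\Delta_0,I,r)$: start with $S=\emptyset$. For $i=0,\dots,I-1$: if $r=1$ set $(\rho_i,\delta_i)=(\rho/I,\delta/I)$; otherwise set $\rho_i=\rho\, r^{I-i-1}\frac{1-r}{1-r^I}$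 and $\delta_i=\delta\, r^{I-i-1}\frac{1-r}{1-r^I}$. Compute $P_i=\mathrm{WG}_{\rho_i,\delta_i,\Delta_0}(W_1,\dots,W_N)$ on the current lists (fresh randomness), then replace each $W_j$ by $W_j\setminus P_i$ (remove all occurrences of released items) and set $S\leftarrow S\cup P_i$. Output $S$. For distributions $P,Q$ and $\alpha\in(1,\infty)$, $D_\alpha(P\|Q)=\frac{1}{\alpha-1}\log\bigl(\sum_s P(s)^\alpha Q(s)^{1-\alpha}\bigr)$. A mechanism $\mathcal{M}$ satisfies $\delta$-approximate $\rho$-zCDP if for all neighboring $x,x'$ there exist events $E$ (depending on $\mathcal{M}(x)$) and $E'$ (depending on $\mathcal{M}(x')$) with $\Pr[E]\ge1-\delta$, $\Pr[E']\ge1-\delta$, such that for all $\alpha\in(1,\infty)$, $D_\alpha(\mathcal{M}(x)|_E\|\mathcal{M}(x')|_{E'})\le\rho\alpha$ and $D_\alpha(\mathcal{M}(x')|_{E'}\|\mathcal{M}(x)|_{E})\le\rho\alpha$, where $|_E$ denotes conditioning on $E$. *)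

(* Defs.v *)
From HB Require Import structures.
From mathcomp Require Import all_boot all_order all_algebra finmap.
From mathcomp Require Import all_classical all_reals all_analysis.
From mathcomp Require Import normal_distribution.

Set Implicit Arguments.
Unset Strict Implicit.
Unset Printing Implicit Defensive.

Import Order.TTheory GRing.Theory Num.Theory.
Local Open Scope ring_scope.

Section DPSIPS.
Variables (R : realType) (U : choiceType).

Definition ulist := seq U.
Definition dataset := seq ulist.

Definition Phi (t : R) : R :=
  fine (normal_prob 0 1 (`]-oo, t] : set R)%classic).

(** Phi is a continuous increasing bijection R -> (0,1); for p in (0,1)
    this is the unique t with Phi t = p. *)
Definition Phi_inv (p : R) : R := sup [set t : R | Phi t <= p]%classic.

Definition distinct_items (W : ulist) : {fset U} := [fset u | u in W]%fset.

Definition items (x : dataset) : {fset U} :=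
  \big[fsetU/fset0]_(W <- x) distinct_items W.

(** The possible values of \overline{W} for one user: all subsets of the
    distinct items of W of size min(Delta0, #distinct items); each is chosen
    with uniform probability. *)
Definition user_subsets (Delta0 : nat) (W : ulist) : seq {fset U} :=
  let A := distinct_items W in
  enum_fset [fset B in fpowerset A | size (enum_fset B) == minn Delta0 (size (enum_fset A))]%fset.

(** Joint distribution of (\overline{W}_1, ..., \overline{W}_N): a list of
    (outcome, probability) pairs (independent uniform choices per user). *)
Fixpoint choices (Delta0 : nat) (x : dataset) : seq (seq {fset U} * R) :=
  match x with
  | [::] => [:: ([::], 1)]
  | W :: x' =>
      let S := user_subsets Delta0 W in
      flatten [seq [seq (B :: cw.1, cw.2 / (size S)%:R) | cw <- choices Delta0 x'] | B <- S]
  end.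

Definition Hist (c : seq {fset U}) (u : U) : R :=
  \sum_(B <- c | u \in B) (Num.sqrt (size (enum_fset B))%:R)^-1.

Definition Hsupp (c : seq {fset U}) : {fset U} := \big[fsetU/fset0]_(B <- c) B.

Definition sigma (rho : R) : R := (Num.sqrt (2 * rho))^-1.

(** T = max_{k in [Delta0]} 1/sqrt k + sigma Phi^{-1}((1-delta)^{1/k})
    (for Delta0 = 0 the value is irrelevant: no item has nonzero weight). *)
Definition Tk (rho delta : R) (k : nat) : R :=
  (Num.sqrt k%:R)^-1 + sigma rho * Phi_inv ((1 - delta) `^ (k%:R)^-1).
Definition thresh (rho delta : R) (Delta0 : nat) : R :=
  \big[Num.max/Tk rho delta 1]_(1 <= k < Delta0.+1) Tk rho delta k.

Definition release_prob (rho T h : R) : R :=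
  fine (normal_prob 0 (sigma rho) (`[T - h, +oo[ : set R)%classic).

(** Probability that the thresholding step outputs exactly O, given the
    chosen subsets c (independent noise per item of the support of H). *)
Definition thr_prob (rho T : R) (c : seq {fset U}) (O : {fset U}) : R :=
  if fsubset O (Hsupp c) then
    \prod_(u <- enum_fset (Hsupp c))
      (if u \in O then release_prob rho T (Hist c u)
       else 1 - release_prob rho T (Hist c u))
  else 0.

Definition WG (rho delta : R) (Delta0 : nat) (x : dataset) (O : {fset U}) : R :=
  \sum_(cw <- choices Delta0 x) cw.2 * thr_prob rho (thresh rho delta Delta0) cw.1 O.

Definition remove_items (P : {fset U}) (x : dataset) : dataset :=
  [seq [seq u <- W | u \notin P] | W <- x].

Definition budgets (rho delta : R) (I : nat) (r : R) : seq (R * R) :=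
  [seq (if r == 1 then (rho / I%:R, delta / I%:R)
        else (rho * r ^+ (I - i - 1) * (1 - r) / (1 - r ^+ I),
              delta * r ^+ (I - i - 1) * (1 - r) / (1 - r ^+ I)))
  | i <- iota 0 I].

(** Run the remaining iterations from current lists x and current output
    Sacc; returns the distribution of the final S.  The WG output on x is
    supported on subsets of items x, so summing over them is the law of
    total probability. *)
Fixpoint run (Delta0 : nat) (bs : seq (R * R)) (x : dataset) (Sacc : {fset U})
  : {fset U} -> R :=
  match bs with
  | [::] => fun S => (S == Sacc)%:R
  | b :: bs' => fun S =>
      \sum_(P <- enum_fset (fpowerset (items x)))
        WG b.1 b.2 Delta0 x P * run Delta0 bs' (remove_items P x) (fsetU Sacc P) S
  end.

Definition DPSIPS (rho delta : R) (Delta0 I : nat) (r : R) (x : dataset)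
  : {fset U} -> R :=
  run Delta0 (budgets rho delta I r) x fset0.

Definition add_one (x x' : dataset) : Prop :=
  exists (W : ulist) (i : nat), x' = take i x ++ W :: drop i x.
Definition neighbors (x x' : dataset) : Prop := add_one x x' \/ add_one x' x.

(** Mechanisms with output a finite set of items, given by their output
    probability mass function. *)
Definition mechanism := dataset -> {fset U} -> R.

(** Conditioning a distribution P on an event E, where the event is given by
    its conditional probability e(s) = P[E | output = s] (E may depend on the
    output and on internal randomness); D is the (finite) outcome range. *)
Definition event_prob (D : seq {fset U}) (e P : {fset U} -> R) : R :=
  \sum_(s <- D) e s * P s.
Definition cond (D : seq {fset U}) (e P : {fset U} -> R) (s : {fset U}) : R :=
  e s * P s / event_prob D e P.

(** D_alpha(P || Q) <= b, with D_alpha(P||Q) =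
    1/(alpha-1) log (sum_s P(s)^alpha Q(s)^(1-alpha)); the divergence is
    +infinity (so the bound fails) unless supp P is contained in supp Q. *)
Definition renyi_le (D : seq {fset U}) (alpha : R) (P Q : {fset U} -> R) (b : R)
  : Prop :=
  (forall s, s \in D -> P s != 0 -> Q s != 0) /\
  (alpha - 1)^-1 * ln (\sum_(s <- D | P s != 0) P s `^ alpha * Q s `^ (1 - alpha))
    <= b.

Definition supported_on_items (M : mechanism) : Prop :=
  forall x S, M x S != 0 -> fsubset S (items x).

(** delta-approximate rho-zCDP.  Since M(x) and M(x') are supported on
    subsets of items (x ++ x'), summing over D below is summing over all
    outcomes. *)
Definition approx_zCDP (M : mechanism) (rho delta : R) : Prop :=
  supported_on_items M /\
  forall x x' : dataset, neighbors x x' ->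
    let D := enum_fset (fpowerset (items (x ++ x'))) in
    exists e e' : {fset U} -> R,
      (forall s, 0 <= e s <= 1) /\ (forall s, 0 <= e' s <= 1) /\
      1 - delta <= event_prob D e (M x) /\
      1 - delta <= event_prob D e' (M x') /\
      forall alpha : R, 1 < alpha ->
        renyi_le D alpha (cond D e (M x)) (cond D e' (M x')) (rho * alpha) /\
        renyi_le D alpha (cond D e' (M x')) (cond D e (M x)) (rho * alpha).

End DPSIPS.

(* Main.v *)
(** For a fixed order [al > 1], the bound [a^al <= k * b^(al-1)] on a pair of
    weights is equivalent to the family of linear inequalities
    [al * t^(al-1) * a <= k + (al-1) * t^al * b] for [t > 0].  It is therefore
    stable under sums and integrals (joint convexity and data processing) and,
    in its first form, under products (tensorization).  Applied to Gaussian
    densities it bounds one noisy threshold test; a shift of [l2]-norm at most 1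
    of the histogram then costs [rho].

    For a dataset [x] and its extension by a user sampling [B], couple all other
    samples.  With probability at least [1 - delta] no item of [B] outside the
    support of the histogram of [x] is released, by the choice of the threshold.
    Replacing the law of the extended run by this restricted law, normalised
    separately for each outcome of the sampling so that the mixture weights are
    unchanged, gives a law [Q] that is [rho]-close to the law for [x], while
    [(1 - delta) Q] lies below the law for the extension.  Such pairs compose
    over the iterations, and the event for the extension is given by the
    density of [prod_i (1 - delta_i) Q] with respect to the output law. *)
Require Import Defs.
From HB Require Import structures.
From mathcomp Require Import all_boot all_order all_algebra finmap.
From mathcomp Require Import all_classical all_reals all_analysis.
From mathcomp Require Import measurable_realfun normal_distribution.
From mathcomp Require Import zify ring lra.
Import Order.TTheory GRing.Theory Num.Theory.
Import numFieldNormedType.Exports.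
Set Implicit Arguments.
Unset Strict Implicit.
Unset Printing Implicit Defensive.
Local Open Scope ring_scope.

(** * The weight inequality of order [al] and its tangent form *)

Section RenyiTerm.
Variables (R : realType) (al : R).
Hypothesis al1 : 1 < al.

Definition pow_le (a b k : R) := a `^ al <= k * b `^ (al - 1).

Lemma al_gt0 : 0 < al. Proof. exact: lt_trans ltr01 al1. Qed.

(** Young's inequality with conjugate exponents [al] and [al / (al - 1)], applied to the [al]-th
    root of [k] and to [y], whose power of order [al / (al - 1)] is [t^al * b]. *)
Lemma tangent_of_pow_le (a b k : R) : 0 <= a -> 0 <= b -> 0 <= k ->
  pow_le a b k ->
  forall t, 0 < t -> al * t `^ (al - 1) * a <= k + (al - 1) * t `^ al * b.
Proof.
move=> a0 b0 k0 H t t0; have al0 := al_gt0.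
have aln0 : al != 0 by rewrite gt_eqF.
have al10 : 0 < al - 1 by rewrite subr_gt0.
have al1n0 : al - 1 != 0 by rewrite gt_eqF.
have {}H : a <= k `^ al^-1 * b `^ ((al - 1) / al).
  have -> : a = (a `^ al) `^ al^-1 by rewrite -powRrM mulfV// powRr1.
  rewrite (powRrM b) -powRM ?powR_ge0//.
  apply: ge0_ler_powR => //; rewrite ?nnegrE ?powR_ge0 ?mulr_ge0 ?powR_ge0//.
  by rewrite invr_ge0 ltW.
pose y := (t `^ al * b) `^ ((al - 1) / al).
have Hy : t `^ (al - 1) * b `^ ((al - 1) / al) = y.
  rewrite /y powRM ?powR_ge0//; congr (_ * _).
  by rewrite -powRrM; congr (_ `^ _); rewrite mulrCA mulfV// mulr1.
have Y := @conjugate_powR R (k `^ al^-1) y al (al / (al - 1))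
  (powR_ge0 _ _) (powR_ge0 _ _) al0.
have {}Y := Y (divr_gt0 al0 al10).
have /Y : al^-1 + (al / (al - 1))^-1 = 1 by field; rewrite aln0 al1n0.
have -> : y `^ (al / (al - 1)) = t `^ al * b.
  rewrite /y -powRrM.
  have -> : (al - 1) / al * (al / (al - 1)) = 1 by field; rewrite aln0 al1n0.
  by rewrite powRr1 ?mulr_ge0 ?powR_ge0.
rewrite -powRrM mulVf// powRr1// => {}Y.
apply: (@le_trans _ _ (al * (k `^ al^-1 * y))).
  rewrite -Hy -mulrA ler_pM2l// mulrCA ler_pM2l ?powR_gt0//.
apply: (le_trans (ler_wpM2l (ltW al0) Y)).
suff -> : al * (k / al + t `^ al * b / (al / (al - 1))) =
          k + (al - 1) * t `^ al * b by [].
by field; rewrite aln0 al1n0.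
Qed.

(** For positive [a] and [b] a single tangent suffices, the one at [t = a / b], where Young's
    inequality is tight. The zero cases are treated apart. *)
Lemma pow_le_of_tangent (a b k : R) : 0 <= a -> 0 <= b -> 0 <= k ->
  (forall t, 0 < t -> al * t `^ (al - 1) * a <= k + (al - 1) * t `^ al * b) ->
  pow_le a b k.
Proof.
rewrite /pow_le le_eqVlt => /predU1P[<- b0 k0 _|a0].
  have al0 := al_gt0; by rewrite powR0 ?gt_eqF// mulr_ge0// powR_ge0.
have al0 := al_gt0; have al10 : 0 < al - 1 by rewrite subr_gt0.
rewrite le_eqVlt => /predU1P[<- k0 H|b0 k0 H].
  (* With [b = 0] and [a > 0], this [t] makes the left-hand side equal to [k + 1], while the
     right-hand side is only [k]. *)
  exfalso; have t0 : 0 < ((k + 1) / (al * a)) `^ (al - 1)^-1.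
    by rewrite powR_gt0// divr_gt0 ?mulr_gt0//; lra.
  move: (H _ t0); rewrite -powRrM mulVf ?gt_eqF// powRr1; last first.
    by rewrite divr_ge0 ?mulr_ge0 ?ltW//; lra.
  have -> : al * ((k + 1) / (al * a)) * a = k + 1 by field; rewrite !gt_eqF.
  by rewrite mulr0; lra.
have t0 : 0 < a / b by rewrite divr_gt0.
move: (H _ t0).
have -> : (a / b) `^ al = a `^ al / (b * b `^ (al - 1)).
  rewrite mulr_powRB1 ?ltW// powRM ?invr_ge0 ?ltW//; congr (_ * _).
  by rewrite -powR_inv1 ?ltW// -powRrM mulN1r powRN.
have -> : (a / b) `^ (al - 1) = a `^ al / a / b `^ (al - 1).
  rewrite powRM ?invr_ge0 ?ltW// -powR_inv1 ?ltW// -powRrM mulN1r powRN.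
  by congr (_ * _); rewrite -(@mulr_powRB1 _ a al) ?ltW// mulrAC divff ?gt_eqF// mul1r.
set A := a `^ al; set B := b `^ (al - 1).
have B0 : 0 < B by rewrite powR_gt0.
have -> : al * (A / a / B) * a = al * (A / B) by field; rewrite !gt_eqF.
have -> : (al - 1) * (A / (b * B)) * b = (al - 1) * (A / B) by field; rewrite !gt_eqF.
move=> {}H; have : A / B <= k by lra.
by rewrite ler_pdivrMr.
Qed.

Lemma pow_le_sum (I : Type) (s : seq I) (P : pred I) (a b k : I -> R) :
  (forall i, P i -> 0 <= a i) -> (forall i, P i -> 0 <= b i) ->
  (forall i, P i -> 0 <= k i) ->
  (forall i, P i -> pow_le (a i) (b i) (k i)) ->
  pow_le (\sum_(i <- s | P i) a i) (\sum_(i <- s | P i) b i)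
         (\sum_(i <- s | P i) k i).
Proof.
move=> a0 b0 k0 H; apply: pow_le_of_tangent; rewrite ?sumr_ge0//.
move=> t t0; rewrite !mulr_sumr -big_split/=; apply: ler_sum => i Pi.
by apply: tangent_of_pow_le => //; auto.
Qed.

Lemma pow_leM (a b k a' b' k' : R) :
  0 <= a -> 0 <= b -> 0 <= a' -> 0 <= b' ->
  pow_le a b k -> pow_le a' b' k' -> pow_le (a * a') (b * b') (k * k').
Proof.
move=> a0 b0 a0' b0' H H'; rewrite /pow_le !powRM// mulrACA.
by apply: ler_pM; rewrite ?powR_ge0.
Qed.

Lemma pow_le_refl (a : R) : 0 <= a -> pow_le a a a.
Proof.
by move=> a0; rewrite /pow_le mulr_powRB1//; exact: al_gt0.
Qed.

End RenyiTerm.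

(** * Gaussian densities and probabilities *)

Section Gaussian.
Variable R : realType.
Implicit Types (m s t a b x : R).
Local Open Scope classical_set_scope.

Lemma normal_pdf_affine a b m s x : 0 < a -> 0 < s ->
  normal_pdf (a * m + b) (a * s) (a * x + b) * a = normal_pdf m s x.
Proof.
move=> a0 s0; have as0 : 0 < a * s by rewrite mulr_gt0.
rewrite !normal_pdfE ?gt_eqF// /normal_peak /normal_fun.
have -> : (a * s) ^+ 2 * pi *+ 2 = a ^+ 2 * (s ^+ 2 * pi *+ 2).
  by rewrite exprMn -mulrA -mulrnAr.
rewrite sqrtrM ?sqr_ge0// sqrtr_sqr gtr0_norm// invfM.
have -> : - (a * x + b - (a * m + b)) ^+ 2 / ((a * s) ^+ 2 *+ 2) =
  - (x - m) ^+ 2 / (s ^+ 2 *+ 2) by field; rewrite !gt_eqF.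
by rewrite mulrC -!mulrA mulVKf ?gt_eqF.
Qed.

Lemma derive1_affine a b : (fun x : R => a * x + b)^`() = cst a.
Proof.
apply/funext => x; rewrite derive1E deriveD// derive_cst addr0.
by rewrite deriveM// derive_cst derive_id scaler0 addr0 scaler1.
Qed.

(** Change of variables along [x |-> a * x + b]. Slope 1 moves the mean; a zero offset rescales the
    standard normal to deviation [sigma rho]. *)
Lemma normal_prob_tail_affine a b m s t : 0 < a -> 0 < s ->
  normal_prob m s `[t, +oo[ =
  normal_prob (a * m + b) (a * s) `[a * t + b, +oo[.
Proof.
move=> a0 s0; rewrite /normal_prob.
have as0 : a * s != 0 by rewrite gt_eqF// mulr_gt0.
rewrite (@increasing_ge0_integration_by_substitutiony R (fun x => a * x + b)).
- apply: eq_integral => x _; rewrite derive1_affine !fctE.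
  by rewrite (normal_pdf_affine b m x a0 s0).
- by move=> x y _ _ xy; rewrite ltrD2r ltr_pM2l.
- by rewrite derive1_affine => ? _; exact: cst_continuous.
- by rewrite derive1_affine; exact: is_cvg_cst.
- by rewrite derive1_affine; exact: is_cvg_cst.
- split => //; apply: cvg_at_right_filter; apply: cvgD; last exact: cvg_cst.
  by apply: cvgM; [exact: cvg_cst|exact: cvg_id].
- apply/cvgryPge => A; exists ((A - b) / a); split; first exact: num_real.
  by move=> x /ltW; rewrite ler_pdivrMr// mulrC lerBlDr.
- apply: continuous_subspaceT; exact: continuous_normal_pdf.
- by move=> x _; exact: normal_pdf_ge0.
Qed.

Lemma normal_prob_tail_shift h s t : 0 < s ->
  normal_prob 0 s `[t - h, +oo[ = normal_prob h s `[t, +oo[.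
Proof.
move=> s0; rewrite (normal_prob_tail_affine h 0 (t - h) (@ltr01 R) s0).
by rewrite mulr0 add0r !mul1r subrK.
Qed.

(** The Renyi integral of order [al] between two Gaussians of deviation [s] whose means differ by
    [d]. *)
Definition gauss_cost al d s : R := expR (al * (al - 1) * d ^+ 2 / (2 * s ^+ 2)).

(** Completing the square: the density at [m] to the power [al] times the density at [n] to the
    power [1 - al] is the cost times a Gaussian density of mean [al * m + (1 - al) * n]. The bound
    is in fact an equality. *)
Lemma pow_le_normal_pdf al m n s x : 1 < al -> 0 < s ->
  pow_le al (normal_pdf m s x) (normal_pdf n s x)
    (gauss_cost al (m - n) s * normal_pdf (al * m + (1 - al) * n) s x).
Proof.
move=> al1 s0; rewrite /pow_le !normal_pdfE ?gt_eqF//.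
have p0 : 0 < normal_peak s by rewrite normal_peak_gt0// gt_eqF.
rewrite !powRM ?normal_fun_ge0 ?(ltW p0)//.
rewrite -(mulr_powRB1 (ltW p0) (al_gt0 al1)).
rewrite /normal_fun /gauss_cost -!expRM.
set p := normal_peak s; set q := p `^ _.
rewrite (_ : expR _ * (p * expR _) * (q * expR _) = p * q *
  expR (al * (al - 1) * (m - n) ^+ 2 / (2 * s ^+ 2) +
  (- (x - (al * m + (1 - al) * n)) ^+ 2 / (s ^+ 2 *+ 2)) +
  (- (x - n) ^+ 2 / (s ^+ 2 *+ 2) * (al - 1)))); last first.
  rewrite !expRD; ring.
rewrite ler_pM2l ?mulr_gt0 ?powR_gt0// ler_expR.
suff -> : - (x - m) ^+ 2 / (s ^+ 2 *+ 2) * al =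
  al * (al - 1) * (m - n) ^+ 2 / (2 * s ^+ 2) +
  (- (x - (al * m + (1 - al) * n)) ^+ 2 / (s ^+ 2 *+ 2)) +
  (- (x - n) ^+ 2 / (s ^+ 2 *+ 2) * (al - 1)) by [].
by field; rewrite gt_eqF.
Qed.

Lemma normal_prob_fin_num m s (A : set R) : measurable A ->
  normal_prob m s A \is a fin_num.
Proof. by move=> mA; exact: fin_num_measure. Qed.

(** The pointwise tangent inequalities are linear in the densities, so they integrate over [A] for
    each fixed [t]; the integrated family then gives back the power form. *)
Lemma pow_le_normal_prob al m n s (A : set R) : 1 < al -> 0 < s ->
  measurable A ->
  pow_le al (fine (normal_prob m s A)) (fine (normal_prob n s A))
    (gauss_cost al (m - n) s *
     fine (normal_prob (al * m + (1 - al) * n) s A)).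
Proof.
move=> al1 s0 mA; have al0 := al_gt0 al1.
have K0 : 0 <= gauss_cost al (m - n) s by exact: expR_ge0.
have mpdf k : measurable_fun A (EFin \o normal_pdf k s).
  by apply/measurable_EFinP; apply: measurable_funTS; exact: measurable_normal_pdf.
have pdf0 k x : A x -> (0 <= (normal_pdf k s x)%:E)%E.
  by move=> _; rewrite lee_fin normal_pdf_ge0.
apply: pow_le_of_tangent => //; rewrite ?fine_ge0 ?mulr_ge0 ?fine_ge0 ?measure_ge0//.
move=> t t0.
have c0 : 0 <= al * t `^ (al - 1) by rewrite mulr_ge0 ?powR_ge0// ltW.
have d0 : 0 <= (al - 1) * t `^ al by rewrite mulr_ge0 ?powR_ge0// subr_ge0 ltW.
have [N NE] : exists N : R -> R, forall k, fine (normal_prob k s A) = N k.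
  by exists (fun k => fine (normal_prob k s A)).
rewrite !NE.
have mass c k : 0 <= c -> ((c * N k)%:E =
    \int[lebesgue_measure]_(x in A) (c%:E * (normal_pdf k s x)%:E))%E.
  move=> c_ge0; rewrite -NE EFinM fineK ?normal_prob_fin_num//.
  by rewrite ge0_integralZl//; [exact: mpdf|exact: pdf0].
have mZ c k : measurable_fun A (fun x => (c%:E * (normal_pdf k s x)%:E)%E).
  by apply: measurable_funeM; exact: mpdf.
have Z0 c k x : 0 <= c -> A x -> (0 <= c%:E * (normal_pdf k s x)%:E)%E.
  by move=> c_ge0 Ax; rewrite mule_ge0 ?lee_fin ?normal_pdf_ge0.
rewrite -lee_fin EFinD.
rewrite (mass _ m c0) (mass _ (al * m + (1 - al) * n) K0) (mass _ n d0).
rewrite -ge0_integralD => //;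
  [|by move=> x; exact: Z0|exact: mZ|by move=> x; exact: Z0|exact: mZ].
apply: ge0_le_integral => //; [by move=> x; exact: Z0|exact: mZ| |].
  by apply: emeasurable_funD; exact: mZ.
move=> x _; rewrite -!EFinM -EFinD lee_fin.
apply: tangent_of_pow_le => //; rewrite ?normal_pdf_ge0 ?mulr_ge0 ?normal_pdf_ge0//.
exact: pow_le_normal_pdf.
Qed.

End Gaussian.

(** * One noisy threshold test *)

Section Release.
Variable R : realType.
Implicit Types (rho T h p q t : R).
Local Open Scope classical_set_scope.

Lemma sigma_gt0 rho : 0 < rho -> 0 < sigma rho.
Proof. by move=> r0; rewrite /sigma invr_gt0 sqrtr_gt0 mulr_gt0. Qed.

Lemma release_probE rho T h : 0 < rho ->
  release_prob rho T h = fine (normal_prob h (sigma rho) `[T, +oo[).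
Proof.
by move=> r0; rewrite /release_prob normal_prob_tail_shift// sigma_gt0.
Qed.

Lemma normal_prob_itvC m s t :
  1 - fine (normal_prob m s `[t, +oo[) = fine (normal_prob m s `]-oo, t[).
Proof.
rewrite -setCitvr; have mA : measurable `[t, +oo[ by [].
rewrite (@probability_setC _ _ _ (normal_prob m s))//.
rewrite -[X in (_ - X)%E]fineK ?normal_prob_fin_num//.
Qed.

Lemma release_probC rho T h : 0 < rho ->
  1 - release_prob rho T h = fine (normal_prob h (sigma rho) `]-oo, T[).
Proof. by move=> r0; rewrite release_probE// normal_prob_itvC. Qed.

Lemma release_prob_ge0 rho T h : 0 <= release_prob rho T h.
Proof. by rewrite fine_ge0// measure_ge0. Qed.

Lemma release_prob_le1 rho T h : 0 < rho -> release_prob rho T h <= 1.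
Proof.
by move=> r0; rewrite -subr_ge0 release_probC// fine_ge0// measure_ge0.
Qed.

Definition bern p (b : bool) : R := if b then p else 1 - p.

Lemma bern_release_ge0 rho T h b : 0 < rho ->
  0 <= bern (release_prob rho T h) b.
Proof.
move=> r0; case: b; first exact: release_prob_ge0.
by rewrite subr_ge0 release_prob_le1.
Qed.

Lemma gauss_cost_sigma al d rho : 0 < rho ->
  gauss_cost al d (sigma rho) = expR (al * (al - 1) * (rho * d ^+ 2)).
Proof.
move=> r0; rewrite /gauss_cost /sigma exprVn sqr_sqrtr ?mulr_ge0 ?ltW//.
by congr expR; field; rewrite gt_eqF.
Qed.

(** The two outcomes are complementary half-lines for the noisy value. Their witnesses are the cost
    times the masses that one and the same Gaussian of mean [l] gives to them, so they add up to
    exactly the cost. *)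
Lemma bern_release_pow_le al rho T h h' : 1 < al -> 0 < rho ->
  exists k : bool -> R, [/\ forall b, 0 <= k b,
    k true + k false = expR (al * (al - 1) * (rho * (h - h') ^+ 2)) &
    forall b, pow_le al (bern (release_prob rho T h) b)
                        (bern (release_prob rho T h') b) (k b)].
Proof.
move=> al1 r0; have s0 := sigma_gt0 r0.
pose l := al * h + (1 - al) * h'; pose K := gauss_cost al (h - h') (sigma rho).
exists (fun b => K * fine (normal_prob l (sigma rho)
                     (if b then `[T, +oo[ else `]-oo, T[))); split.
- by move=> b; rewrite mulr_ge0 ?expR_ge0 ?fine_ge0 ?measure_ge0.
- by rewrite -normal_prob_itvC -mulrDr addrC subrK mulr1 /K gauss_cost_sigma.
- by case; rewrite /= ?release_probC// ?release_probE//;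
    apply: pow_le_normal_prob.
Qed.

Lemma PhiE t : Phi t = 1 - fine (normal_prob 0 1 `[t, +oo[).
Proof.
rewrite normal_prob_itvC /Phi /normal_prob integral_itv_bndo_bndc//.
by apply/measurable_EFinP; apply: measurable_funTS; exact: measurable_normal_pdf.
Qed.

End Release.

(** * The quantile function and the choice of the threshold *)

Section Threshold.
Variable R : realType.
Implicit Types (rho T h p q t : R).
Local Open Scope classical_set_scope.

(** Under the standard normal law the identity is a random variable whose distribution function is
    [Phi]; monotonicity, limits and right continuity of [Phi] follow from this. *)
Let idTR : measurableTypeR R -> R := idfun.

#[local] HB.instance Definition _ :=
  @isMeasurableFun.Build _ _ _ _ idTR (@measurable_id _ _ setT).

Let X : {RV (normal_prob 0 1 : probability (measurableTypeR R) R) >-> R} := idTR.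

Lemma Phi_cdf : @Phi R = fine \o cdf X.
Proof. by []. Qed.

Lemma Phi_nondecreasing : {homo @Phi R : s t / s <= t}.
Proof.
move=> s t st; rewrite Phi_cdf fine_le ?fin_num_measure//.
exact: cdf_nondecreasing.
Qed.

Lemma Phi_cvgy : Phi t @[t --> +oo] --> (1 : R).
Proof. rewrite Phi_cdf; exact/fine_cvg/cvg_cdfy1. Qed.

Lemma Phi_cvgNy : Phi t @[t --> -oo] --> (0 : R).
Proof. rewrite Phi_cdf; exact/fine_cvg/cvg_cdfNy0. Qed.

Lemma Phi_right_continuous s : Phi t @[t --> s^'+] --> (Phi s : R).
Proof.
rewrite Phi_cdf; apply: fine_cvg.
by rewrite fineK ?fin_num_measure//; exact: cdf_right_continuous.
Qed.

(** The limits at both infinities make the set under the supremum nonempty and bounded. Points to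
    the right of the supremum lie outside it, so [Phi] exceeds [q] there, and right continuity
    carries the bound to the supremum. *)
Lemma Phi_inv_ge q : 0 < q < 1 -> q <= Phi (Phi_inv q).
Proof.
move=> /andP[q0 q1]; rewrite /Phi_inv; set S := [set t | _].
have S0 : S !=set0.
  have /filter_ex[t qt] : \forall t \near -oo, Phi t < q.
    exact: (cvgr_lt _ Phi_cvgNy _ q0).
  by exists t; exact: ltW.
have Sub : has_ubound S.
  have /filter_ex[t qt] : \forall t \near +oo, q < Phi t.
    exact: (cvgr_gt _ Phi_cvgy _ q1).
  exists t => u; rewrite /S/= => uq; rewrite leNgt; apply/negP => /ltW.
  by move=> /Phi_nondecreasing /(lt_le_trans qt); rewrite ltNge uq.
apply: (cvgr_to_ge (@Phi_right_continuous (sup S))).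
near=> t; rewrite leNgt; apply/negP => /ltW tq.
have : t <= sup S by exact: ub_le_sup.
by rewrite leNgt => /negP; apply; near: t; exact: nbhs_right_gt.
Unshelve. all: by end_near. Qed.

Lemma Tk_le_thresh rho delta (D0 k : nat) : (1 <= k <= D0)%N ->
  Tk rho delta k <= thresh rho delta D0.
Proof.
move=> /andP[k1 kD]; rewrite /thresh.
have : k \in index_iota 1 D0.+1 by rewrite mem_index_iota k1.
by move=> /le_bigmax_seq; exact.
Qed.

(** An item held only by a user who contributes [k] items has weight [1 / sqrt k]. As the threshold
    is at least [Tk rho delta k], the noise must reach [sigma rho * Phi_inv q] for a release. *)
Lemma new_item_unreleased rho delta (D0 k : nat) : 0 < rho ->
  0 < delta < 1 -> (1 <= k <= D0)%N ->
  (1 - delta) `^ (k%:R)^-1 <=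
  1 - release_prob rho (thresh rho delta D0) (Num.sqrt k%:R)^-1.
Proof.
move=> r0 /andP[d0 d1] kD; have s0 := sigma_gt0 r0.
set q := _ `^ _.
have k0 : 0 < (k%:R : R)^-1 by rewrite invr_gt0 ltr0n; case/andP: kD.
have q01 : 0 < q < 1.
  rewrite powR_gt0 ?subr_gt0//=; apply: lt_le_trans (_ : 1 `^ k%:R^-1 <= 1).
    by apply: gt0_ltr_powR; rewrite ?nnegrE ?ltrBlDr ?ltrDl// subr_ge0 ltW.
  by rewrite powR1.
rewrite lerBrDr addrC -lerBrDr.
apply: (@le_trans _ _ (1 - Phi (Phi_inv q))); last by rewrite lerD2l lerN2 Phi_inv_ge.
rewrite PhiE subKr (normal_prob_tail_affine 0 0 (Phi_inv q) s0 ltr01).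
rewrite mulr0 !addr0 mulr1 /release_prob fine_le ?normal_prob_fin_num//.
apply: le_measure; rewrite ?inE//; apply: subset_itvr; rewrite bnd_simp.
by rewrite lerBrDl; exact: Tk_le_thresh.
Qed.

End Threshold.

(** * Laws of random finite sets, mixtures and independent inclusion *)

Section FiniteLaws.
Variables (R : realType) (U : choiceType).
Implicit Types (A B O S : {fset U}) (P Q : {fset U} -> R).
Local Open Scope fset_scope.
Local Open Scope ring_scope.

Definition pmf_on A P :=
  [/\ forall S, 0 <= P S, forall S, ~~ (S `<=` A) -> P S = 0 &
      \sum_(S <- fpowerset A) P S = 1].

Lemma pmf_on_sub A B P : A `<=` B -> pmf_on A P -> pmf_on B P.
Proof.
move=> AB [P0 Pout P1]; split => // [S|].
  by move=> SB; apply: Pout; apply: contra SB => /fsubset_trans; exact.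
rewrite -P1; apply/esym/big_fset_incl; first by rewrite fpowersetS.
by move=> S _; rewrite fpowersetE => /Pout.
Qed.

Lemma pmf_on_mix (I : eqType) (s : seq I) (w : I -> R)
    (kap : I -> {fset U} -> R) A :
  (forall i, i \in s -> 0 <= w i) -> \sum_(i <- s) w i = 1 ->
  (forall i, i \in s -> pmf_on A (kap i)) ->
  pmf_on A (fun S => \sum_(i <- s) w i * kap i S).
Proof.
move=> w0 w1 kapP; split=> [S|S SA|].
- by rewrite big_seq sumr_ge0// => i si; case: (kapP i si) => k0 _ _; rewrite mulr_ge0 ?w0.
- by rewrite big_seq big1// => i si; case: (kapP i si) => _ -> //; rewrite mulr0.
- rewrite exchange_big/= -[RHS]w1 !big_seq; apply: eq_bigr => i si.
  by rewrite -mulr_sumr; case: (kapP i si) => _ _ ->; rewrite mulr1.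
Qed.

Lemma sum_fset_le_supp (T : choiceType) (D E : {fset T}) (k : T -> R) :
  (forall x, 0 <= k x) -> (forall x, x \notin E -> k x = 0) ->
  \sum_(x <- D) k x <= \sum_(x <- E) k x.
Proof.
move=> k0 kE; have -> : \sum_(x <- E) k x = \sum_(x <- D `|` E) k x.
  by apply: big_fset_incl; [exact: fsubsetUr|move=> x _; exact: kE].
rewrite (big_fsetID _ (mem D) (D `|` E))/=.
have -> : [fset x in D `|` E | x \in D] = D.
  by apply/fsetP => x; rewrite !inE/= andbC; case: (x \in D).
by rewrite lerDl sumr_ge0.
Qed.

(* The witness [k] dominates the summand [P^al * Q^(1-al)] of the Renyi sum;
   bounding its sums over all finite sets avoids tracking supports. *)
Definition renyi_dom (al : R) P Q (K : R) := exists k : {fset U} -> R,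
  [/\ forall S, 0 <= k S, forall S, pow_le al (P S) (Q S) (k S) &
      forall D : {fset {fset U}}, \sum_(S <- D) k S <= K].

(** The witness is the mixture of the witnesses [k i] with weights [c i]. Equal weights [a = b = c]
    give joint convexity; distinct weights give adaptive composition, where [i] is the first output
    and the costs multiply. *)
Lemma renyi_dom_mix (al : R) (I : eqType) (s : seq I) (a b c : I -> R)
    (kap kap' : I -> {fset U} -> R) (K1 K2 : R) :
  1 < al -> 0 <= K2 ->
  (forall i, i \in s -> [/\ 0 <= a i, 0 <= b i, 0 <= c i & pow_le al (a i) (b i) (c i)]) ->
  \sum_(i <- s) c i <= K1 ->
  (forall i S, i \in s -> 0 <= kap i S) ->
  (forall i S, i \in s -> 0 <= kap' i S) ->
  (forall i, i \in s -> renyi_dom al (kap i) (kap' i) K2) ->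
  renyi_dom al (fun S => \sum_(i <- s) a i * kap i S)
               (fun S => \sum_(i <- s) b i * kap' i S) (K1 * K2).
Proof.
move=> al1 K20 abc cK kap0 kap0' H.
have /choice[k kP] : forall i, exists k : {fset U} -> R, i \in s ->
  [/\ forall S, 0 <= k S, forall S, pow_le al (kap i S) (kap' i S) (k S) &
      forall D : {fset {fset U}}, \sum_(S <- D) k S <= K2].
  move=> i; case: (boolP (i \in s)) => [/H[k]|_]; first by exists k.
  by exists (fun=> 0).
exists (fun S => \sum_(i <- s) c i * k i S); split=> [S|S|D].
- rewrite big_seq sumr_ge0// => i si.
  by have [_ _ c0 _] := abc i si; have [k0 _ _] := kP i si; rewrite mulr_ge0.
- rewrite !(big_seq _ _ s); apply: pow_le_sum => // i si;
    have [a0 b0 c0 abcP] := abc i si; have [k0 kk _] := kP i si.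
  + by rewrite mulr_ge0 ?kap0.
  + by rewrite mulr_ge0 ?kap0'.
  + by rewrite mulr_ge0.
  + by apply: pow_leM; rewrite ?kap0 ?kap0'.
- rewrite exchange_big/= (@le_trans _ _ (\sum_(i <- s) c i * K2))//.
    rewrite !big_seq; apply: ler_sum => i si; rewrite -mulr_sumr.
    by have [_ _ c0 _] := abc i si; have [_ _ kD] := kP i si; rewrite ler_wpM2l.
  by rewrite -mulr_suml ler_wpM2r.
Qed.

(** Distributivity, by induction on [A]: after an element [a] is removed, the subsets split into
    those that contain [a] and those that do not. *)
Lemma sum_fpowerset_prod A (f : U -> bool -> R) :
  \sum_(O <- fpowerset A) \prod_(u <- A) f u (u \in O) =
  \prod_(u <- A) (f u true + f u false).
Proof.
elim/finSet_rect: A => A IH.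
have [->|[a aA]] := fset_0Vmem A.
  by rewrite fpowerset0 big_seq_fset1 !big_seq_fset0.
have aB : a \notin A `\ a by rewrite !inE eqxx.
rewrite -(fsetD1K aA); set B := A `\ a in aB *.
have {}IH : \sum_(O <- fpowerset B) \prod_(u <- B) f u (u \in O) =
  \prod_(u <- B) (f u true + f u false) by apply: IH; rewrite fproperD1.
clearbody B.
rewrite (big_fsetU1 _ _ aB)/= mulrDl -IH.
rewrite [LHS](big_fsetID _ (fun O => a \in O) (fpowerset _))/=; congr (_ + _)%R.
- have -> : [fset O in fpowerset (a |` B) | a \in O] =
      [fset a |` O | O in fpowerset B].
    apply/fsetP => O; apply/idP/imfsetP.
      rewrite !inE/= fpowersetE => /andP[OaB aO]; exists (O `\ a).
        rewrite /= fpowersetE; apply/fsubsetP => u; rewrite !in_fsetD1.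
        by move=> /andP[ua /(fsubsetP OaB)]; rewrite in_fset1U (negbTE ua).
      by rewrite fsetD1K.
    by case=> S /=; rewrite fpowersetE => SB ->; rewrite !inE/= fpowersetE eqxx andbT fsetUS.
  rewrite big_imfset/=; last first.
    move=> S S'; rewrite !fpowersetE => SB SB' /(congr1 (fun X => X `\ a)).
    rewrite !fsetU1K//; last by apply: contra aB; exact: fsubsetP.
    by apply: contra aB; exact: fsubsetP.
  rewrite mulr_sumr; apply: eq_bigr => O _.
  rewrite (big_fsetU1 _ _ aB)/= !inE eqxx; congr (_ * _).
  rewrite !big_seq; apply: eq_bigr => u uB; rewrite !inE.
  by case: eqP => // ua; rewrite ua (negbTE aB) in uB.
- have -> : [fset O in fpowerset (a |` B) | a \notin O] = fpowerset B.
    apply/fsetP => O; rewrite !inE/= !fpowersetE.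
    apply/andP/idP => [[OaB aO]|OB].
      apply/fsubsetP => u uO; have := fsubsetP OaB u uO; rewrite !inE.
      by case: eqP => // ua; rewrite -ua uO in aO.
    split; first by rewrite (fsubset_trans OB)// fsubsetUr.
    by apply: contra aB; exact: fsubsetP.
  rewrite mulr_sumr !big_seq; apply: eq_bigr => O; rewrite fpowersetE => OB.
  rewrite (big_fsetU1 _ _ aB)/=; congr (f _ _ * _).
  by apply/negbTE; apply: contra aB; exact: fsubsetP.
Qed.

(** The law of a random subset of [A] that includes each [u] independently with probability [p u].
    The support [A] and the probabilities are separate arguments, so that an extended histogram can
    be tested on the old support alone. *)
Definition thr A (p : U -> R) O : R :=
  if O `<=` A then \prod_(u <- A) bern (p u) (u \in O) else 0.

Lemma sum_subset_prod A (f : U -> bool -> R) :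
  \sum_(O <- fpowerset A)
     (if O `<=` A then \prod_(u <- A) f u (u \in O) else 0) =
  \prod_(u <- A) (f u true + f u false).
Proof.
rewrite -sum_fpowerset_prod !big_seq; apply: eq_bigr => O.
by rewrite fpowersetE => ->.
Qed.

Lemma pmf_on_thr A (p : U -> R) :
  (forall u b, 0 <= bern (p u) b) -> pmf_on A (thr A p).
Proof.
move=> p0; split=> [ O|O /negbTE OA|].
- by rewrite /thr; case: ifP => // _; rewrite prodr_ge0.
- by rewrite /thr OA.
- rewrite /thr (sum_subset_prod _ (fun u => bern (p u))) big1// => u _.
  by rewrite /bern addrC subrK.
Qed.

(** Tensorization: the product of the one-item witnesses has total mass the product of their masses,
    so the exponents [e u] add up. *)
Lemma renyi_dom_thr (al : R) A (p p' e : U -> R) (K : R) : 1 < al ->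
  (forall u b, 0 <= bern (p u) b) -> (forall u b, 0 <= bern (p' u) b) ->
  (forall u, exists k : bool -> R, [/\ forall b, 0 <= k b,
     k true + k false = expR (al * (al - 1) * e u) &
     forall b, pow_le al (bern (p u) b) (bern (p' u) b) (k b)]) ->
  \sum_(u <- A) e u <= K ->
  renyi_dom al (thr A p) (thr A p') (expR (al * (al - 1) * K)).
Proof.
move=> al1 p0 p0' /choice[k kP] eK.
have k0 u b : 0 <= k u b by case: (kP u).
pose kk O := if O `<=` A then \prod_(u <- A) k u (u \in O) else 0.
have kk0 O : 0 <= kk O by rewrite /kk; case: ifP => // _; rewrite prodr_ge0.
exists kk; split=> // [ O|D].
  rewrite /thr /kk; case: ifP => _; last first.
    by rewrite /pow_le powR0 ?gt_eqF ?(al_gt0 al1)// mul0r.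
  (* Nonnegativity of both products is carried along because [pow_leM] requires it of its
     factors. *)
  suff [] : [/\ 0 <= \prod_(u <- A) bern (p u) (u \in O),
     0 <= \prod_(u <- A) bern (p' u) (u \in O) &
     pow_le al (\prod_(u <- A) bern (p u) (u \in O))
      (\prod_(u <- A) bern (p' u) (u \in O)) (\prod_(u <- A) k u (u \in O))] by [].
  elim/big_ind3 : _ => [|a b c a' b' c' [? ? ?] [? ? ?]|u _].
  - by rewrite ler01; split => //; exact: pow_le_refl.
  - by rewrite !mulr_ge0//; split => //; exact: pow_leM.
  - by split => //; case: (kP u).
have kkA O : O \notin fpowerset A -> kk O = 0.
  by rewrite fpowersetE /kk => /negbTE ->.
apply: le_trans (sum_fset_le_supp D kk0 kkA) _.
rewrite (sum_subset_prod _ k) (eq_bigr (fun u => expR (al * (al - 1) * e u))); last first.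
  by move=> u _; case: (kP u).
rewrite -expR_sum ler_expR -mulr_sumr ler_wpM2l// mulr_ge0 ?subr_ge0 ?ltW//.
exact: al_gt0.
Qed.

End FiniteLaws.

(** * One round of the Weighted Gaussian mechanism on neighboring datasets *)

Section WeightedGaussian.
Variables (R : realType) (U : choiceType).
Implicit Types (A B O S : {fset U}) (c : seq {fset U}) (W : ulist U)
  (x : dataset U) (rho delta T : R).
Local Open Scope fset_scope.
Local Open Scope ring_scope.

Lemma items_cons W x : items (W :: x) = distinct_items W `|` items x.
Proof. by rewrite /items big_cons. Qed.

Lemma items_cat x y : items (x ++ y) = items x `|` items y.
Proof. by rewrite /items big_cat. Qed.

Lemma Hsupp_cons B c : Hsupp (B :: c) = B `|` Hsupp c.
Proof. by rewrite /Hsupp big_cons. Qed.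

Lemma mem_user_subsets D0 W B : B \in user_subsets D0 W ->
  B `<=` distinct_items W /\ (#|` B| <= D0)%N.
Proof.
rewrite /user_subsets !inE/= fpowersetE => /andP[BW /eqP sB].
by split => //; rewrite sB geq_minl.
Qed.

(** The first [n] items of [W] form an admissible sample; without one the uniform weights would not
    sum to 1. *)
Lemma size_user_subsets_gt0 D0 W : (0 < size (user_subsets D0 W))%N.
Proof.
set A := distinct_items W; pose n := minn D0 #|` A|.
pose B := [fset u in take n (enum_fset A)].
suff : B \in user_subsets D0 W by case: user_subsets.
rewrite /user_subsets !inE/= fpowersetE; apply/andP; split.
  apply/fsubsetP => u uB; apply: (@mem_take n).
  by move: uB; rewrite in_fset.
apply/eqP; rewrite -/A -/n.
by rewrite card_fseq undup_id ?take_uniq ?fset_uniq// size_takel// geq_minr.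
Qed.

Lemma sum_choices_cons D0 W x (F : seq {fset U} -> R) :
  \sum_(cw <- choices R D0 (W :: x)) cw.2 * F cw.1 =
  \sum_(B <- user_subsets D0 W) (size (user_subsets D0 W))%:R^-1 *
    \sum_(cw <- choices R D0 x) cw.2 * F (B :: cw.1).
Proof.
rewrite /= big_flatten big_map; apply: eq_bigr => B _.
rewrite big_map mulr_sumr; apply: eq_bigr => cw _ /=.
by rewrite mulrAC mulrC.
Qed.

Lemma sum_user_weights D0 W :
  \sum_(B <- user_subsets D0 W) (size (user_subsets D0 W))%:R^-1 = 1 :> R.
Proof.
rewrite big_const_seq count_predT iter_addr_0 -[RHS](@mulVf _ (size (user_subsets D0 W))%:R).
  by rewrite mulr_natr.
by rewrite pnatr_eq0 -lt0n size_user_subsets_gt0.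
Qed.

(** Marginalising the sample of the first user. This lets the law for [x] be written over the
    samples for [W :: x], which is the coupling used below. *)
Lemma sum_choices_behead D0 W x (F : seq {fset U} -> R) :
  \sum_(cw <- choices R D0 (W :: x)) cw.2 * F (behead cw.1) =
  \sum_(cw <- choices R D0 x) cw.2 * F cw.1.
Proof.
rewrite (sum_choices_cons _ _ _ (F \o behead))/= -mulr_suml.
by rewrite sum_user_weights mul1r.
Qed.

Lemma sum_choices D0 x : \sum_(cw <- choices R D0 x) cw.2 = 1.
Proof.
suff : \sum_(cw <- choices R D0 x) cw.2 * (fun=> 1) cw.1 = 1.
  by under eq_bigr do rewrite mulr1.
elim: x => [|W x IH]; first by rewrite big_seq1 mulr1.
by rewrite (sum_choices_behead _ _ _ (fun=> 1)).
Qed.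

Lemma choices_ge0 D0 x cw : cw \in choices R D0 x -> 0 <= cw.2.
Proof.
elim: x cw => [|W x IH] cw /=; first by rewrite inE => /eqP ->.
move=> /flatten_mapP[B _ /mapP[cw' /IH cw0 ->]] /=.
by rewrite divr_ge0.
Qed.

Lemma mem_choices_cons D0 W x cw : cw \in choices R D0 (W :: x) ->
  exists B c, [/\ cw.1 = B :: c, B \in user_subsets D0 W &
    exists2 cw', cw' \in choices R D0 x & cw'.1 = c].
Proof.
move=> /flatten_mapP[B BW /mapP[cw' cwx ->]] /=.
by exists B, cw'.1; split => //; exists cw'.
Qed.

Lemma Hsupp_choices D0 x cw : cw \in choices R D0 x -> Hsupp cw.1 `<=` items x.
Proof.
elim: x cw => [|W x IH] cw.
  by rewrite inE => /eqP ->; rewrite /Hsupp big_nil fsub0set.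
move=> /mem_choices_cons[B [c [-> /mem_user_subsets[BW _] [cw' /IH + <-]]]].
by rewrite Hsupp_cons items_cons; exact: fsetUSS.
Qed.

(** Samples are independent, so for a symmetric [F] the inserted user can be moved to the front,
    past one user at a time. *)
Lemma sum_choices_insert D0 y W z (F : seq {fset U} -> R) :
  (forall c c', perm_eq c c' -> F c = F c') ->
  \sum_(cw <- choices R D0 (y ++ W :: z)) cw.2 * F cw.1 =
  \sum_(cw <- choices R D0 (W :: y ++ z)) cw.2 * F cw.1.
Proof.
elim: y F => // V y IH F Fperm.
rewrite cat_cons !sum_choices_cons.
transitivity (\sum_(B <- user_subsets D0 V) \sum_(C <- user_subsets D0 W)
  ((size (user_subsets D0 V))%:R^-1 * ((size (user_subsets D0 W))%:R^-1 *
    \sum_(cw <- choices R D0 (y ++ z)) cw.2 * F (B :: C :: cw.1)))).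
  apply: eq_bigr => B _; rewrite (IH (fun c => F (B :: c))); last first.
    by move=> c c' cc'; apply: Fperm; rewrite perm_cons.
  by rewrite (sum_choices_cons _ _ _ (fun c => F (B :: c))) mulr_sumr.
rewrite exchange_big/=; apply: eq_bigr => C _.
rewrite (sum_choices_cons _ _ _ (fun c => F (C :: c))) mulr_sumr.
apply: eq_bigr => B _.
rewrite mulrCA; congr (_ * (_ * _)); apply: eq_bigr => cw _; congr (_ * _).
by apply: Fperm; rewrite -(cat1s B) -(cat1s C) perm_catCA.
Qed.

Lemma thr_probE rho T c O :
  thr_prob rho T c O = thr (Hsupp c) (fun u => release_prob rho T (Hist R c u)) O.
Proof. by []. Qed.

Lemma thr_prob_perm rho T O c c' : perm_eq c c' ->
  thr_prob rho T c O = thr_prob rho T c' O.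
Proof.
move=> cc'; have HE u : Hist R c u = Hist R c' u by exact: perm_big.
have SE : Hsupp c = Hsupp c' by exact: perm_big.
rewrite !thr_probE /thr SE; case: ifP => // _.
by apply: eq_bigr => u _; rewrite HE.
Qed.

Lemma pmf_on_WG rho delta D0 x : 0 < rho -> pmf_on (items x) (WG rho delta D0 x).
Proof.
move=> r0; apply: pmf_on_mix.
- by move=> cw; exact: choices_ge0.
- exact: sum_choices.
- move=> cw /Hsupp_choices cwx; apply: pmf_on_sub cwx _.
  by apply: pmf_on_thr => u b; exact: bern_release_ge0.
Qed.

Definition weight B u : R := if u \in B then (Num.sqrt (#|` B|)%:R)^-1 else 0.

Lemma Hist_cons B c u : Hist R (B :: c) u = weight B u + Hist R c u.
Proof. by rewrite /Hist big_cons /weight; case: ifP => //; rewrite add0r. Qed.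

Lemma Hist_notin c u : u \notin Hsupp c -> Hist R c u = 0.
Proof.
elim: c => [|B c IH]; first by rewrite /Hist big_nil.
rewrite Hsupp_cons Hist_cons inE negb_or => /andP[uB /IH ->].
by rewrite /weight (negbTE uB) addr0.
Qed.

Lemma weight_sqr B u : weight B u ^+ 2 = if u \in B then (#|` B|)%:R^-1 else 0.
Proof.
rewrite /weight; case: ifP => _; last by rewrite expr0n.
by rewrite exprVn sqr_sqrtr.
Qed.

(** A nonempty [B] has [#|B|] items of squared weight [1 / #|B|], hence norm 1; an empty one has
    norm 0. This is the sensitivity of the histogram. *)
Lemma sum_weight_sqr A B : \sum_(u <- A) weight B u ^+ 2 <= 1.
Proof.
have [->|B0] := eqVneq B fset0.
  by rewrite big1// => u _; rewrite weight_sqr inE.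
have -> : 1 = \sum_(u <- B) weight B u ^+ 2 :> R.
  under eq_big_seq => u uB do rewrite weight_sqr uB.
  rewrite big_const_seq count_predT iter_addr_0 -(mulr_natr (_^-1)) mulVf//.
  by rewrite pnatr_eq0 cardfs_eq0.
apply: sum_fset_le_supp => u; first exact: sqr_ge0.
by rewrite weight_sqr => /negbTE ->.
Qed.

(** Each new item has weight exactly [1 / sqrt k] with [k] the size of [B], so it stays unreleased
    with probability at least [q], the [k]-th root of [1 - delta]. *)
Lemma new_items_unreleased rho delta D0 B c : 0 < rho -> 0 < delta < 1 ->
  (#|` B| <= D0)%N ->
  1 - delta <= \prod_(u <- B `\` Hsupp c)
     bern (release_prob rho (thresh rho delta D0) (Hist R (B :: c) u)) false.
Proof.
move=> r0 d01 BD; have /andP[d0 d1] := d01.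
have [B0|B0] := eqVneq #|` B| 0%N.
  rewrite (cardfs0_eq B0) fset0D big_seq_fset0.
  by rewrite lerBlDr lerDl ltW.
set k := #|` B| in B0 BD *; set q := (1 - delta) `^ k%:R^-1.
have q0 : 0 <= q by exact: powR_ge0.
have q1 : q <= 1.
  rewrite -[leRHS](congr1 (fun f => f k%:R^-1) (@powR1 R)).
  apply: ge0_ler_powR; rewrite ?nnegrE ?invr_ge0 ?ler0n ?subr_ge0 ?(ltW d1)//.
  by rewrite lerBlDr lerDl ltW.
have -> : 1 - delta = q ^+ k.
  rewrite -powR_mulrn// /q -powRrM mulVf ?pnatr_eq0// powRr1//.
  by rewrite subr_ge0 ltW.
(* At most [k] items are new, and fewer factors only enlarge the product since [q <= 1]. *)
apply: (@le_trans _ _ (q ^+ #|` B `\` Hsupp c|)).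
  by apply: ler_wiXn2l => //; apply: fsubset_leq_card; exact: fsubsetDl.
have -> : q ^+ #|` B `\` Hsupp c| = \prod_(u <- B `\` Hsupp c) q.
  by rewrite big_const_seq count_predT iter_mulr_1.
rewrite !(big_seq _ _ (enum_fset (B `\` Hsupp c))).
apply: ler_prod => u; rewrite inE => /andP[uc uB].
rewrite q0 /bern/= Hist_cons (Hist_notin uc) addr0 /weight uB.
by apply: new_item_unreleased => //; rewrite lt0n B0.
Qed.

(** For an outcome inside the old support, the product splits into the old items, which give the
    restricted law, and the new items, all unreleased, whose factor is at least [1 - delta]. Other
    outcomes have restricted mass 0. *)
Lemma thr_prob_restrict rho delta D0 B c O : 0 < rho -> 0 < delta < 1 ->
  (#|` B| <= D0)%N ->
  (1 - delta) * thr (Hsupp c)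
    (fun u => release_prob rho (thresh rho delta D0) (Hist R (B :: c) u)) O <=
  thr_prob rho (thresh rho delta D0) (B :: c) O.
Proof.
move=> r0 d01 BD; rewrite thr_probE Hsupp_cons /thr.
pose p u := release_prob rho (thresh rho delta D0) (Hist R (B :: c) u).
have p0 u b : 0 <= bern (p u) b by exact: bern_release_ge0.
case: ifP => [Oc|_]; last first.
  by rewrite mulr0; case: ifP => // _; apply: prodr_ge0 => u _; exact: p0.
rewrite (fsubset_trans Oc) ?fsubsetUr//.
rewrite (big_fsetID _ (mem (Hsupp c)) (B `|` Hsupp c))/=.
have -> : [fset u in B `|` Hsupp c | u \in Hsupp c] = Hsupp c.
  by apply/fsetP => u; rewrite !inE/= andbC; case: (u \in Hsupp c); rewrite ?orbT.
have -> : [fset u in B `|` Hsupp c | u \notin Hsupp c] = B `\` Hsupp c.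
  by apply/fsetP => u; rewrite !inE/= andbC; case: (u \in Hsupp c); rewrite ?orbF.
rewrite mulrC ler_wpM2l//; first by apply: prodr_ge0 => u _; exact: p0.
rewrite (le_trans (new_items_unreleased c r0 d01 BD))//.
rewrite !(big_seq _ _ (enum_fset (B `\` Hsupp c))).
suff E : forall u, u \in B `\` Hsupp c -> bern (p u) false = bern (p u) (u \in O).
  by rewrite (eq_bigr _ E).
move=> u; rewrite inE => /andP[uc _]; congr bern; apply/esym/negbTE.
by apply: contra uc; exact: fsubsetP.
Qed.

Lemma WG_neighbor rho delta D0 y W z : 0 < rho -> 0 < delta < 1 ->
  exists Q : {fset U} -> R,
  [/\ pmf_on (items (y ++ z)) Q,
      forall O, (1 - delta) * Q O <= WG rho delta D0 (y ++ W :: z) O &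
      forall al, 1 < al ->
        renyi_dom al (WG rho delta D0 (y ++ z)) Q (expR (al * (al - 1) * rho)) /\
        renyi_dom al Q (WG rho delta D0 (y ++ z)) (expR (al * (al - 1) * rho))].
Proof.
move=> r0 d01; set T := thresh rho delta D0; set s := choices R D0 (W :: y ++ z).
pose p c u := release_prob rho T (Hist R c u).
have p0 c u b : 0 <= bern (p c u) b by exact: bern_release_ge0.
(* Both kernels test only the old support; [kap] uses the histogram without the new user, [kap'] the
   one with that user. *)
pose kap (cw : seq {fset U} * R) := thr (Hsupp (behead cw.1)) (p (behead cw.1)).
pose kap' (cw : seq {fset U} * R) := thr (Hsupp (behead cw.1)) (p cw.1).
have WGE : WG rho delta D0 (y ++ z) = (fun O => \sum_(cw <- s) cw.2 * kap cw O).
  by apply/funext => O; rewrite /s (sum_choices_behead _ _ _ (fun c => thr_prob rho T c O)).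
have s_sub cw : cw \in s -> Hsupp (behead cw.1) `<=` items (y ++ z).
  by move=> /mem_choices_cons[B [c [-> _ [cw' /Hsupp_choices + <-]]]].
have kapP cw : cw \in s -> pmf_on (items (y ++ z)) (kap cw).
  by move=> /s_sub cwx; apply: pmf_on_sub cwx _; exact: pmf_on_thr.
have kapP' cw : cw \in s -> pmf_on (items (y ++ z)) (kap' cw).
  by move=> /s_sub cwx; apply: pmf_on_sub cwx _; exact: pmf_on_thr.
exists (fun O => \sum_(cw <- s) cw.2 * kap' cw O); split.
- apply: pmf_on_mix => //; first by move=> cw; exact: choices_ge0.
  exact: sum_choices.
- move=> O; rewrite /WG 
    (@sum_choices_insert D0 y W z (thr_prob rho T ^~ O) (@thr_prob_perm rho T O)).
  rewrite mulr_sumr -/s !big_seq; apply: ler_sum => cw cws.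
  rewrite mulrCA ler_wpM2l ?(choices_ge0 cws)// /kap'.
  have [B [c [-> BW _]]] := mem_choices_cons cws.
  by apply: thr_prob_restrict => //; case: (mem_user_subsets BW).
move=> al al1; have al0 := al_gt0 al1; rewrite WGE -[expR _]mul1r.
have w_le cw : cw \in s ->
    [/\ 0 <= cw.2, 0 <= cw.2, 0 <= cw.2 & pow_le al cw.2 cw.2 cw.2].
  by move=> /choices_ge0 w0; split => //; exact: pow_le_refl.
have s1 : \sum_(cw <- s) cw.2 <= 1 by rewrite sum_choices.
have kap0 cw O : cw \in s -> 0 <= kap cw O by move=> /kapP[].
have kap0' cw O : cw \in s -> 0 <= kap' cw O by move=> /kapP'[].
(* On the old support the two histograms differ by the weights of [B], whose squares sum to at most
   1. *)
have cost cw : cw \in s ->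
    \sum_(u <- Hsupp (behead cw.1))
      rho * (Hist R (behead cw.1) u - Hist R cw.1 u) ^+ 2 <= rho.
  move=> /mem_choices_cons[B [c [-> _ _]]] /=; rewrite -mulr_sumr.
  rewrite -[leRHS]mulr1 ler_wpM2l ?(ltW r0)//.
  apply: le_trans (sum_weight_sqr (Hsupp c) B).
  by apply: ler_sum => u _; rewrite Hist_cons opprD addrCA subrr addr0 sqrrN.
pose w (cw : seq {fset U} * R) := cw.2.
split.
- apply: (@renyi_dom_mix _ _ al _ s w w w kap kap' 1 _ al1 (expR_ge0 _)) => // cw cws.
  apply: (renyi_dom_thr al1 (p0 _) (p0 _) _ (cost _ cws)) => u.
  exact: bern_release_pow_le.
- apply: (@renyi_dom_mix _ _ al _ s w w w kap' kap 1 _ al1 (expR_ge0 _)) => // cw cws.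
  apply: (renyi_dom_thr al1 (p0 _) (p0 _) _ (cost _ cws)) => u.
  have [k [k0 kE kP]] := bern_release_pow_le T (Hist R cw.1 u)
    (Hist R (behead cw.1) u) al1 r0.
  by exists k; split => //; rewrite kE -sqrrN opprB.
Qed.

End WeightedGaussian.

(** * Composition over the rounds, the budget split, and passage to conditioned laws *)

Section Composition.
Variables (R : realType) (U : choiceType).
Implicit Types (A B O S : {fset U}) (W : ulist U)
  (x y z : dataset U) (rho delta : R) (bs : seq (R * R)).
Local Open Scope fset_scope.
Local Open Scope ring_scope.

Lemma items_remove_sub B x : items (remove_items B x) `<=` items x.
Proof.
elim: x => [|W x IH]; first by rewrite /items big_nil.
rewrite /= !items_cons; apply: fsetUSS => //; apply/fsubsetP => u.
by rewrite /distinct_items !in_fset/= mem_filter => /andP[].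
Qed.

Lemma pmf_on_dirac A : pmf_on A (fun S => (S == A)%:R : R).
Proof.
split=> [S|S SA|]; first by rewrite ler0n.
  by case: eqP => // SE; rewrite SE fsubset_refl in SA.
rewrite (big_fsetD1 A) ?fpowersetE ?fsubset_refl//= eqxx big_seq big1 ?addr0//.
by move=> S; rewrite !inE => /andP[/negbTE ->].
Qed.

Definition valid_budget (b : R * R) := (0 < b.1) && (0 < b.2 < 1).

Lemma pmf_on_run D0 bs x A : all valid_budget bs ->
  pmf_on (A `|` items x) (run D0 bs x A).
Proof.
elim: bs x A => [|b bs IH] x A /=.
  by move=> _; apply: pmf_on_sub (fsubsetUl _ _) _; exact: pmf_on_dirac.
move=> /andP[/andP[b0 _] bsP].
have [w0 _ w1] := pmf_on_WG b.2 D0 x b0.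
apply: pmf_on_mix => // B; rewrite fpowersetE => Bx.
apply: pmf_on_sub (IH _ _ bsP).
by rewrite -fsetUA fsetUS// fsubUset Bx items_remove_sub.
Qed.

(** Induction over the rounds. Removing the same released set from both datasets keeps them of the
    form [y ++ z] and [y ++ W :: z], so the hypothesis applies with shortened lists and a larger
    accumulator. *)
Lemma run_neighbor D0 bs y W z A : all valid_budget bs ->
  exists Q : {fset U} -> R,
  [/\ pmf_on (A `|` items (y ++ z)) Q,
      forall S, (\prod_(b <- bs) (1 - b.2)) * Q S <= run D0 bs (y ++ W :: z) A S &
      forall al, 1 < al ->
        renyi_dom al (run D0 bs (y ++ z) A) Q
          (expR (al * (al - 1) * \sum_(b <- bs) b.1)) /\
        renyi_dom al Q (run D0 bs (y ++ z) A)
          (expR (al * (al - 1) * \sum_(b <- bs) b.1))].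
Proof.
elim: bs y W z A => [|b bs IH] y W z A /=.
  move=> _; exists (fun S => (S == A)%:R); split.
  - by apply: pmf_on_sub (fsubsetUl _ _) _; exact: pmf_on_dirac.
  - by move=> S; rewrite big_nil mul1r.
  - move=> al al1; rewrite big_nil mulr0 expR0.
    suff H : renyi_dom al (fun S => (S == A)%:R) (fun S => (S == A)%:R) 1 by [].
    exists (fun S => (S == A)%:R); split=> [S|S|D]; first by rewrite ler0n.
      by apply: pow_le_refl => //; rewrite ler0n.
    have [d0 dout d1] := pmf_on_dirac A.
    rewrite -[leRHS]d1; apply: sum_fset_le_supp => // S.
    by rewrite fpowersetE; exact: dout.
move=> /andP[/andP[b0 b01] bsP].
have b2lt1 : b.2 < 1 by case/andP: b01.
have [Q1 [Q1P Q1le Q1al]] := WG_neighbor D0 y W z b0 b01.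
have /choice[Q2 Q2P] := fun B => IH (remove_items B y)
  [seq u <- W | u \notin B] (remove_items B z) (A `|` B) bsP.
have rem_cat B x x' : remove_items B (x ++ x') = remove_items B x ++ remove_items B x'.
  exact: map_cat.
have Q10 B : 0 <= Q1 B by case: Q1P.
have Q20 B S : 0 <= Q2 B S by case: (Q2P B) => -[].
have prod0 : 0 <= \prod_(b <- bs) (1 - b.2).
  rewrite big_seq prodr_ge0// => b' /(allP bsP) /andP[_ /andP[_ /ltW]].
  by rewrite subr_ge0.
(* The first output follows [Q1], and the later rounds follow the law [Q2 B] given by induction for
   the lists that remain. *)
exists (fun S => \sum_(B <- fpowerset (items (y ++ z))) Q1 B * Q2 B S); split.
- have [_ _ Q11] := Q1P; apply: pmf_on_mix => // B; rewrite fpowersetE => Byz.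
  have [Q2B _ _] := Q2P B; apply: pmf_on_sub Q2B.
  by rewrite -fsetUA fsetUS// fsubUset Byz -rem_cat items_remove_sub.
- move=> S; rewrite big_cons.
  have yz_sub : items (y ++ z) `<=` items (y ++ W :: z).
    by rewrite !items_cat items_cons fsetUS// fsubsetUr.
  (* The run on the extension sums over more subsets; the additional ones have mass 0 under [Q1]. *)
  rewrite (big_fset_incl _ (_ : _ `<=` fpowerset (items (y ++ W :: z)))); last 2 first.
  + by rewrite fpowersetS.
  + move=> B _; rewrite fpowersetE => Byz.
    by have [_ -> // _] := Q1P; rewrite mul0r.
  rewrite mulr_sumr; apply: ler_sum => B _; rewrite mulrACA rem_cat.
  have [_ Q2le _] := Q2P B.
  by apply: ler_pM; rewrite ?mulr_ge0 ?subr_ge0 ?(ltW b2lt1).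
- move=> al al1; have [[k [k0 kP kK]] [k' [k0' kP' kK']]] := Q1al _ al1.
  have WG0 B : 0 <= WG b.1 b.2 D0 (y ++ z) B by case: (pmf_on_WG b.2 D0 (y ++ z) b0).
  pose kap B := run D0 bs (remove_items B (y ++ z)) (A `|` B).
  have kap0 B S : 0 <= kap B S.
    by have [+ _ _] := pmf_on_run D0 (remove_items B (y ++ z)) (A `|` B) bsP; exact.
  pose K := expR (al * (al - 1) * \sum_(b <- b :: bs) b.1).
  have KE : K = expR (al * (al - 1) * b.1) *
      expR (al * (al - 1) * \sum_(b <- bs) b.1).
    by rewrite /K big_cons mulrDr expRD.
  rewrite -/K KE; split.
  + apply: (@renyi_dom_mix _ _ al _ _ (WG b.1 b.2 D0 (y ++ z)) Q1 k kap Q2 _ _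
             al1 (expR_ge0 _)) => //.
    by move=> B _; rewrite /kap rem_cat; have [_ _ /(_ _ al1)[]] := Q2P B.
  + apply: (@renyi_dom_mix _ _ al _ _ Q1 (WG b.1 b.2 D0 (y ++ z)) k' Q2 kap _ _
             al1 (expR_ge0 _)) => //.
    by move=> B _; rewrite /kap rem_cat; have [_ _ /(_ _ al1)[]] := Q2P B.
Qed.

(** Weierstrass' product inequality: expanding one factor at a time drops only the nonnegative term
    [d i] times the remaining sum. *)
Lemma prod_one_minus_ge (I : eqType) (s : seq I) (d : I -> R) :
  (forall i, i \in s -> 0 <= d i <= 1) ->
  1 - \sum_(i <- s) d i <= \prod_(i <- s) (1 - d i).
Proof.
elim: s => [|i s IH] d01; first by rewrite !big_nil subr0.
have d01s j : j \in s -> 0 <= d j <= 1 by move=> js; rewrite d01// inE js orbT.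
rewrite !big_cons; have /andP[di0 di1] := d01 i (mem_head _ _).
have s0 : 0 <= \sum_(j <- s) d j.
  by rewrite big_seq sumr_ge0// => j /d01s /andP[].
apply: (@le_trans _ _ ((1 - d i) * (1 - \sum_(j <- s) d j))); last first.
  by rewrite ler_wpM2l ?subr_ge0// IH.
have := mulr_ge0 di0 s0; lra.
Qed.

Lemma geometric_sum_gt0 (I : nat) (r : R) : (0 < I)%N -> 0 < r ->
  0 < \sum_(j < I) r ^+ j.
Proof.
case: I => // n _ r0; rewrite big_ord_recl expr0.
by apply: ltr_pwDl => //; apply: sumr_ge0 => j _; rewrite exprn_ge0 ?ltW.
Qed.

(** Since [1 - r ^+ I = (1 - r) * G], the general formula is a division by [G]; at [r = 1] one has
    [G = I], so a single formula covers both cases. *)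
Lemma budgetsE rho delta (I : nat) (r : R) : (0 < I)%N -> 0 < r ->
  let G := \sum_(j < I) r ^+ j in
  budgets rho delta I r =
    [seq (rho * (r ^+ (I - i - 1) / G), delta * (r ^+ (I - i - 1) / G)) | i <- iota 0 I].
Proof.
move=> I0 r0 G; apply: eq_map => i; case: eqP => [r1|/eqP r1].
  have -> : G = I%:R.
    rewrite /G r1 (eq_bigr (fun=> 1)); last by move=> j _; rewrite expr1n.
    by rewrite sumr_const card_ord.
  by rewrite r1 expr1n mul1r.
have G0 : 0 < G by exact: geometric_sum_gt0.
have r1' : 1 - r != 0 by rewrite subr_eq0 eq_sym.
have -> : 1 - r ^+ I = (1 - r) * G.
  by rewrite -opprB subrX1 -/G -mulNr opprB.
by congr (_, _); field; rewrite r1' gt_eqF.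
Qed.

Lemma geometric_weights (I : nat) (r : R) : (0 < I)%N -> 0 < r ->
  let G := \sum_(j < I) r ^+ j in
  (forall i, 0 < r ^+ (I - i - 1) / G) /\
  \sum_(i <- iota 0 I) r ^+ (I - i - 1) / G = 1.
Proof.
move=> I0 r0 G.
have G0 : 0 < G by exact: geometric_sum_gt0.
split=> [i|]; first by rewrite divr_gt0 ?exprn_gt0.
rewrite -mulr_suml -[X in iota 0 X]subn0 -/(index_iota 0 I) big_mkord.
suff -> : \sum_(i < I) r ^+ (I - i - 1) = G by rewrite mulfV// gt_eqF.
rewrite /G (reindex_inj rev_ord_inj)/=; apply: eq_bigr => i _.
by congr (_ ^+ _); have := ltn_ord i; lia.
Qed.

Lemma budgets_spec rho delta (I : nat) (r : R) :
  0 < rho -> 0 < delta < 1 -> (0 < I)%N -> 0 < r ->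
  [/\ all valid_budget (budgets rho delta I r),
      \sum_(b <- budgets rho delta I r) b.1 = rho &
      1 - delta <= \prod_(b <- budgets rho delta I r) (1 - b.2)].
Proof.
move=> rho0 /andP[d0 d1] I0 r0.
pose w i := r ^+ (I - i - 1) / \sum_(j < I) r ^+ j.
have [w0 w1] : (forall i, 0 < w i) /\ \sum_(i <- iota 0 I) w i = 1.
  exact: geometric_weights.
have -> : budgets rho delta I r = [seq (rho * w i, delta * w i) | i <- iota 0 I].
  exact: budgetsE.
clearbody w.
have wle1 i : i \in iota 0 I -> w i <= 1.
  move=> iI; rewrite -w1 (bigD1_seq i) ?iota_uniq//= lerDl.
  by apply: sumr_ge0 => j _; exact: ltW.
have dw i : i \in iota 0 I -> delta * w i < 1.
  move=> iI; apply: le_lt_trans d1.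
  by rewrite -[leRHS]mulr1 ler_wpM2l ?wle1// ltW.
split.
- apply/allP => _ /mapP[i iI ->]; rewrite /valid_budget/= dw// andbT.
  by apply/andP; split; apply: mulr_gt0.
- by rewrite big_map/= -mulr_sumr w1 mulr1.
- rewrite big_map/=; apply: (@le_trans _ _ (1 - \sum_(i <- iota 0 I) delta * w i)).
    by rewrite -mulr_sumr w1 mulr1.
  apply: prod_one_minus_ge => i iI.
  by rewrite mulr_ge0 ?(ltW d0) ?(ltW (w0 i))//= ltW// dw.
Qed.

(** Where [Q] vanishes the power inequality forces [P] to vanish, which gives the support condition;
    elsewhere it bounds each summand by the witness. *)
Lemma renyi_dom_le (D : {fset {fset U}}) (al rho : R) (P Q : {fset U} -> R) :
  1 < al -> 0 <= rho -> (forall S, 0 <= P S) -> (forall S, 0 <= Q S) ->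
  renyi_dom al P Q (expR (al * (al - 1) * rho)) ->
  renyi_le D al P Q (rho * al).
Proof.
move=> al1 rho0 P0 Q0 [k [k0 kP kK]]; have al0 := al_gt0 al1.
have al10 : 0 < al - 1 by rewrite subr_gt0.
have supp S : P S != 0 -> 0 < Q S.
  move=> PS; rewrite lt_neqAle Q0 andbT eq_sym; apply: contra PS => /eqP QS.
  have z0 : (0 : R) `^ (al - 1) = 0 by rewrite powR0// gt_eqF.
  have := kP S; rewrite /pow_le QS z0 mulr0 => PS0.
  apply/eqP/(@powR_eq0_eq0 _ _ al)/eqP.
  by rewrite eq_le PS0 powR_ge0.
split=> [S _ /supp|]; first by move/gt_eqF ->.
rewrite mulrC ler_pdivrMr//.
set X := \sum_(_ <- _ | _) _.
have XK : X <= expR (al * (al - 1) * rho).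
  apply: le_trans (kK D); rewrite /X big_mkcond; apply: ler_sum => S _.
  case: ifPn => // /supp QS; have := kP S; rewrite /pow_le.
  by rewrite -[1 - al]opprB powRN ler_pdivrMr// powR_gt0.
(* For a nonpositive sum [ln] takes its default value 0, and the bound is nonnegative. *)
have [X0|X0] := leP X 0.
  by rewrite ln0// !mulr_ge0 ?(ltW al0) ?(ltW al10).
have := XK; rewrite -ler_ln ?posrE ?expR_gt0// expRK => /le_trans; apply.
suff -> : al * (al - 1) * rho = rho * al * (al - 1) by [].
by ring.
Qed.

(** The event for [P] is certain. The event for [P'] has the density of [c * Q] as its conditional
    probability, so it has probability [c], and conditioning on it yields exactly [Q]. *)
Lemma cond_bounds A (P P' Q : {fset U} -> R) (c rho delta : R) :
  pmf_on A P -> pmf_on A P' -> pmf_on A Q ->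
  0 <= rho -> 0 <= delta -> 0 < c -> 1 - delta <= c ->
  (forall S, c * Q S <= P' S) ->
  (forall al, 1 < al ->
     renyi_dom al P Q (expR (al * (al - 1) * rho)) /\
     renyi_dom al Q P (expR (al * (al - 1) * rho))) ->
  let D := enum_fset (fpowerset A) in
  exists e e' : {fset U} -> R,
    [/\ forall s, 0 <= e s <= 1, forall s, 0 <= e' s <= 1,
        1 - delta <= event_prob D e P, 1 - delta <= event_prob D e' P' &
    forall al : R, 1 < al ->
      renyi_le D al (cond D e P) (cond D e' P') (rho * al) /\
      renyi_le D al (cond D e' P') (cond D e P) (rho * al)].
Proof.
move=> [P0 _ P1] [P0' _ _] [Q0 _ Q1] rho0 delta0 c0 dc cQ H D.
(* Where [P' S = 0] the quotient is 0 by convention, and [Q S] vanishes there as well. *)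
pose e' S := c * Q S / P' S.
have e'P' S : e' S * P' S = c * Q S.
  have [PS|PS] := eqVneq (P' S) 0; last by rewrite divfK.
  have := cQ S; rewrite /e' PS mulr0 pmulr_rle0// => Q0S.
  by apply/esym/eqP; rewrite mulf_eq0 (gt_eqF c0) eq_le Q0S Q0.
have eP : event_prob D (fun=> 1) P = 1.
  by rewrite /event_prob -[RHS]P1; apply: eq_bigr => S _; rewrite mul1r.
have e'PE : event_prob D e' P' = c.
  rewrite /event_prob -[RHS]mulr1 -Q1 mulr_sumr.
  by apply: eq_bigr => S _; rewrite e'P'.
have condE : cond D (fun=> 1) P = P.
  by apply/funext => S; rewrite /cond eP mul1r divr1.
have condE' : cond D e' P' = Q.
  by apply/funext => S; rewrite /cond e'PE e'P' mulrC mulKf// gt_eqF.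
exists (fun=> 1), e'; split.
- by move=> _; rewrite ler01 lexx.
- move=> S; have PS0 := P0' S; rewrite divr_ge0 ?mulr_ge0 ?(ltW c0)//=.
  have [PS|PS] := eqVneq (P' S) 0; first by rewrite /e' PS invr0 mulr0.
  by rewrite ler_pdivrMr ?mul1r// lt_neqAle eq_sym PS.
- by rewrite eP gerBl.
- by rewrite e'PE.
- move=> al al1; have [H1 H2] := H al al1.
  by rewrite condE condE'; split; apply: renyi_dom_le.
Qed.

End Composition.

Theorem mainTheorem4 (R : realType) (U : choiceType)
  (rho delta : R) (Delta0 I : nat) (r : R) :
  0 < rho -> 0 < delta < 1 -> (1 <= I)%N -> 0 < r ->
  approx_zCDP (fun x : dataset U => DPSIPS rho delta Delta0 I r x) rho delta.
Proof.
move=> rho0 d01 I0 r0; have /andP[d0 d1] := d01.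
have [bsP sum1 prod_ge] := budgets_spec rho0 d01 I0 r0.
pose M (x : dataset U) := DPSIPS rho delta Delta0 I r x.
have Mpmf x : pmf_on (items x) (M x).
  by have := pmf_on_run Delta0 x fset0 bsP; rewrite fset0U.
split=> [x S|].
  by apply: contra_neqT => Sx; have [_ out _] := Mpmf x; exact: out.
(* It suffices to treat the case where [x'] extends [x], over any item set [A] containing the items
   of both; the opposite case exchanges the two events and the two bounds. *)
have pair x x' (A : {fset U}) : add_one x x' -> fsubset (items x) A ->
  fsubset (items x') A -> let D := enum_fset (fpowerset A) in
  exists e e' : {fset U} -> R,
    [/\ forall s, 0 <= e s <= 1, forall s, 0 <= e' s <= 1,
        1 - delta <= event_prob D e (M x), 1 - delta <= event_prob D e' (M x') &
    forall al : R, 1 < al ->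
      renyi_le D al (cond D e (M x)) (cond D e' (M x')) (rho * al) /\
      renyi_le D al (cond D e' (M x')) (cond D e (M x)) (rho * al)].
  move=> [W [i x'E]] xA x'A.
  have [Q [Qpmf Qle Qal]] :=
    run_neighbor Delta0 (take i x) W (drop i x) fset0 bsP.
  rewrite cat_take_drop fset0U sum1 -x'E in Qpmf Qle Qal.
  apply: (cond_bounds _ _ (pmf_on_sub xA Qpmf)) Qle Qal => //.
  - exact: pmf_on_sub (Mpmf x).
  - exact: pmf_on_sub (Mpmf x').
  - exact: ltW.
  - exact: ltW.
  - by apply: lt_le_trans prod_ge; rewrite subr_gt0.
move=> x x' xx' D.
have xA : fsubset (items x) (items (x ++ x')) by rewrite items_cat fsubsetUl.
have x'A : fsubset (items x') (items (x ++ x')) by rewrite items_cat fsubsetUr.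
case: xx' => xx'.
  have [e [e' [e01 e01' eP eP' H]]] := pair _ _ _ xx' xA x'A.
  by exists e, e'; exact: (conj e01 (conj e01' (conj eP (conj eP' H)))).
have [e [e' [e01 e01' eP eP' H]]] := pair _ _ _ xx' x'A xA.
exists e', e; refine (conj e01' (conj e01 (conj eP' (conj eP _)))) => al al1.
by have [H1 H2] := H al al1; exact: conj H2 H1.
Qed.
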